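(* Let $m\ge 2$ and let $w_1,\dots,w_m$ be a perfect system of weights on $\mathbb{R}$. Let $n\in\mathbb{N}$ and let $\vec{n}_0,\vec{n}_1,\dots,\vec{n}_n$ be multi-indices (vectors of $m$ non-negative integers) such that $|\vec{n}_j|=j$ for $j=0,\dots,n$ and $\vec{n}_{j+1}\ge\vec{n}_j$ componentwise for $j=0,\dots,n-1$. Put $P_j=P_{\vec{n}_j}$ and $Q_j=Q_{\vec{n}_{j+1}}$ for $j=0,\dots,n-1$. Then, with $\vec{n}=\vec{n}_n$, $$(x-y)\sum_{j=0}^{n-1}P_j(x)Q_j(y)=P_{\vec{n}}(x)Q_{\vec{n}}(y)-\sum_{k=1}^{m}\frac{h_{\vec{n}}^{(k)}}{h_{\vec{n}-\vec{e}_k}^{(k)}}\,P_{\vec{n}-\vec{e}_k}(x)\,Q_{\vec{n}+\vec{e}_k}(y).$$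
   Context: Let $m\ge2$ be an integer and let $w_1,\dots,w_m$ be non-negative functions on $\mathbb{R}$ such that all moments $\int_{-\infty}^{\infty}x^kw_j(x)\,dx$ exist. All integrals are over $\mathbb{R}$. For a vector $\vec{n}=(n_1,\dots,n_m)$ of non-negative integers put $|\vec{n}|=n_1+\dots+n_m$; $\vec{e}_k$ denotes the $k$-th standard basis vector. Type II multiple orthogonal polynomials: $P_{\vec{n}}$ is the monic polynomial of degree $|\vec{n}|$ with $\int P_{\vec{n}}(x)x^kw_j(x)\,dx=0$ for $k=0,\dots,n_j-1$, $j=1,\dots,m$. The system $w_1,\dots,w_m$ is called perfect if for every vector $\vec{n}$ of non-negative integers the polynomial $P_{\vec{n}}$ exists and is unique. Type I multiple orthogonal polynomials: $A_{\vec{n}}^{(k)}$ ($k=1,\dots,m$) are the polynomials with $\deg A_{\vec{n}}^{(k)}\le n_k-1$ such that $Q_{\vec{n}}(x)=\sum_{k=1}^mA_{\vec{n}}^{(k)}(x)w_k(x)$ satisfies $\int x^jQ_{\vec{n}}(x)\,dx=0$ for $j=0,\dots,|\vec{n}|-2$ and $\int x^{|\vec{n}|-1}Q_{\vec{n}}(x)\,dx=1$. For a perfect system these exist and are unique. For every multi-index $\vec{n}$ and $k=1,\dots,m$, $h_{\vec{n}}^{(k)}=\int P_{\vec{n}}(x)x^{n_k}w_k(x)\,dx$, where $n_k$ is the $k$-th component of $\vec{n}$; these numbers are non-zero for a perfect system.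
   Formalization: The terms of the sum over k with n_k = 0, where n − e_k is not a multi-index and P_{n−e_k} and h_{n−e_k}^{(k)} are undefined, are omitted (taken to be 0); the formula is otherwise as stated, for all multi-indices. *)

(* Defs.v *)
From HB Require Import structures.
From mathcomp Require Import all_boot all_order all_algebra.
From mathcomp Require Import all_classical all_reals all_analysis.

Set Implicit Arguments.
Unset Strict Implicit.
Unset Printing Implicit Defensive.

Import Order.TTheory GRing.Theory Num.Theory.

Local Open Scope ring_scope.

Notation multi_index m := {ffun 'I_m -> nat}.

Section MultiIndex.
Variable m : nat.
Implicit Types (n : multi_index m) (k : 'I_m).

Definition mi_size n : nat := (\sum_(k < m) n k)%N.

Definition mi_incr n k : multi_index m := [ffun i => (n i + (i == k))%N].

(* Subtraction on nat is truncated: this is n - e_k only when 0 < n k. *)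
Definition mi_decr n k : multi_index m := [ffun i => (n i - (i == k))%N].

Definition mi_le (n n' : multi_index m) : Prop := forall k, (n k <= n' k)%N.

End MultiIndex.

Section MultipleOrthogonality.
Variables (R : realType) (m : nat) (w : 'I_m -> R -> R).
Implicit Types (n : multi_index m) (P : {poly R})
  (A : {ffun 'I_m -> {poly R}}).

Local Notation leb := (@lebesgue_measure R).

Definition moments_exist : Prop :=
  forall (j : 'I_m) (k : nat),
    leb.-integrable [set: R] (fun x : R => (x ^+ k * w j x)%:E).

Definition is_typeII n P : Prop :=
  [/\ P \is monic, size P = (mi_size n).+1 &
      forall (j : 'I_m) (k : nat), (k < n j)%N ->
        \int[leb]_(x in [set: R]) (P.[x] * x ^+ k * w j x) = 0].

Definition perfect : Prop := forall n, exists! P, is_typeII n P.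

Definition linear_form A (x : R) : R := \sum_(k < m) (A k).[x] * w k x.

(* The conditions are indexed by j.+1 rather than by |n| - 1 and |n| - 2, so
   that for n = 0 there is no condition on moments and the size bounds force
   A = 0. *)
Definition is_typeI n A : Prop :=
  [/\ forall k : 'I_m, (size (A k) <= n k)%N,
      forall j : nat, (j.+1 < mi_size n)%N ->
        \int[leb]_(x in [set: R]) (x ^+ j * linear_form A x) = 0 &
      forall j : nat, j.+1 = mi_size n ->
        \int[leb]_(x in [set: R]) (x ^+ j * linear_form A x) = 1].

(* For a perfect system the polynomials of both types exist and are unique;
   the default value of xget is then irrelevant. *)
Definition typeII n : {poly R} := xget 0 [set P | is_typeII n P]%classic.

Definition typeI n : {ffun 'I_m -> {poly R}} :=
  xget [ffun=> 0] [set A | is_typeI n A]%classic.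

Definition typeI_form n : R -> R := linear_form (typeI n).

Definition hnum n (k : 'I_m) : R :=
  \int[leb]_(x in [set: R]) ((typeII n).[x] * x ^+ n k * w k x).

End MultipleOrthogonality.

(* Main.v *)
From HB Require Import structures.
Require Import Defs.
From mathcomp Require Import all_boot all_order all_algebra.
From mathcomp Require Import all_classical all_reals all_analysis.
From mathcomp Require Import ring.

(* With a_(n,j) = h_n^(j) / h_(n-e_j)^(j), both families satisfy
   nearest-neighbour recurrences with the same b_(n,k):
     x P_n = P_(n+e_k) + b_(n,k) P_n + sum_j a_(n,j) P_(n-e_j),
     x Q_N = Q_n + b_(n,k) Q_N + sum_j a_(N,j) Q_(N+e_j),   N = n + e_k.
   Multiplying the first by Q_N(y) and the second by P_n(x), the difference of
   the right-hand side of the Christoffel-Darboux formula at N and at n equals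
   (x - y) P_n(x) Q_N(y) provided the remaining cross terms cancel, which
   follows from
     P_(n+e_k) - P_(n+e_j) = (h_(n+e_k)^(j) / h_n^(j)) P_n,
     Q_(n+e_j) - Q_(n+e_k) = (h_(n+e_k)^(j) / h_n^(j)) Q_(n+e_j+e_k),   j <> k.
   The formula then telescopes along the path. All of this is algebra for the
   functionals p |-> int p w_k; the identities for Q_n are proved for its vector
   of coefficient polynomials, so they hold at every y and not just almost
   everywhere. *)

Set Implicit Arguments.
Unset Strict Implicit.
Unset Printing Implicit Defensive.

Import Order.TTheory GRing.Theory Num.Theory.

Local Open Scope ring_scope.

(** * Unit steps between multi-indices *)

Section MultiIndexTheory.
Variable m : nat.
Implicit Types (n : multi_index m) (k l : 'I_m).

Lemma mi_incrE n k l : mi_incr n k l = (n l + (l == k))%N.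
Proof. by rewrite ffunE. Qed.

Lemma mi_incr_id n k : mi_incr n k k = (n k).+1.
Proof. by rewrite mi_incrE eqxx addn1. Qed.

Lemma mi_incr_neq n k l : l != k -> mi_incr n k l = n l.
Proof. by rewrite mi_incrE => /negPf->; rewrite addn0. Qed.

Lemma leq_mi_incr n k l : (n l <= mi_incr n k l)%N.
Proof. by rewrite mi_incrE leq_addr. Qed.

Lemma mi_size_incr n k : mi_size (mi_incr n k) = (mi_size n).+1.
Proof.
rewrite /mi_size [LHS](bigD1 k)//= [in RHS](bigD1 k)//= mi_incr_id addSn.
by congr (_ + _).+1; apply: eq_bigr => i /mi_incr_neq ->.
Qed.

Lemma mi_decrK n k : (0 < n k)%N -> mi_incr (mi_decr n k) k = n.
Proof.
move=> nk; apply/ffunP => i; rewrite mi_incrE ffunE subnK//.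
by case: eqP => // ->.
Qed.

Lemma mi_incrK n k : mi_decr (mi_incr n k) k = n.
Proof. by apply/ffunP => i; rewrite ffunE mi_incrE addnK. Qed.

Lemma mi_incr_decr n k l : k != l ->
  mi_decr (mi_incr n k) l = mi_incr (mi_decr n l) k.
Proof.
move=> kl; apply/ffunP => i; rewrite !ffunE.
by have [->|] := eqVneq i l; rewrite ?subn0// eq_sym (negPf kl) !addn0.
Qed.

Lemma mi_size0 n k : mi_size n = 0%N -> n k = 0%N.
Proof. by move/eqP; rewrite sum_nat_eq0 => /forallP/(_ k)/eqP. Qed.

Lemma mi_size_gt0 n : (0 < mi_size n)%N -> exists k, (0 < n k)%N.
Proof.
rewrite lt0n sum_nat_eq0 => /forallPn[k]; rewrite implyTb -lt0n => nk.
by exists k.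
Qed.

(** Some component grows strictly, or the sizes could not differ. Adding a unit there stays below
    [n'] and already has its size, so equality holds in every component. *)
Lemma mi_le_incr n n' : mi_le n n' -> mi_size n' = (mi_size n).+1 ->
  exists k, n' = mi_incr n k.
Proof.
move=> le_nn' sz_n'.
have [[k ltk]|nlt] := pselect (exists k, (n k < n' k)%N); last first.
  have: (mi_size n' <= mi_size n)%N.
    apply: leq_sum => k _; rewrite leqNgt; apply/negP => ltk.
    by apply: nlt; exists k.
  by rewrite sz_n' ltnn.
exists k; apply/ffunP.
have le_incr i : (mi_incr n k i <= n' i)%N.
  have [->|ik] := eqVneq i k; first by rewrite mi_incr_id.
  by rewrite mi_incr_neq.
have /leqif_sum[_] : forall i : 'I_m, true ->
    (mi_incr n k i <= n' i ?= iff (mi_incr n k i == n' i))%N.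
  by move=> i _; split.
rewrite -/(mi_size _) -/(mi_size _) mi_size_incr sz_n' eqxx.
by move=> /esym/forallP eqi i; apply/esym/eqP; apply: implyP (eqi i) _.
Qed.

End MultiIndexTheory.

(** * Top coefficients of polynomials *)

Lemma scalar_coef_top (F : fieldType) (f : {scalar {poly F}}) (d : nat)
    (q : {poly F}) :
  (forall i, (i < d)%N -> f 'X^i = 0) -> (size q <= d.+1)%N ->
  f q = q`_d * f 'X^d.
Proof.
move=> f0 sz_q; have -> : q = \sum_(i < d.+1) q`_i *: 'X^i.
  rewrite -poly_def; apply/polyP => i; rewrite coef_poly.
  by case: ltnP => // /(leq_trans sz_q)/leq_sizeP/(_ i)->.
rewrite -poly_def coef_poly ltnSn poly_def linear_sum big_ord_recr/=.
by rewrite big1 ?add0r ?linearZ// => i _; rewrite linearZ/= f0 ?mulr0.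
Qed.

Lemma size_sub_monic (F : fieldType) (d : nat) (p q : {poly F}) :
  p \is monic -> q \is monic -> size p = d.+1 -> size q = d.+1 ->
  (size (p - q)%R <= d)%N.
Proof.
move=> /monicP + /monicP; rewrite /lead_coef => + + sp sq.
rewrite sp sq /= => p1 q1.
apply/leq_sizeP => i; rewrite leq_eqVlt => /predU1P[<-|di].
  by rewrite coefB p1 q1 subrr.
by rewrite coefB !nth_default ?subrr ?sp ?sq.
Qed.

Lemma size_drop_top (F : fieldType) (d : nat) (p : {poly F}) :
  (size p <= d.+1)%N -> p`_d = 0 -> (size p <= d)%N.
Proof.
move=> sp pd; apply/leq_sizeP => i; rewrite leq_eqVlt => /predU1P[<-//|di].
by rewrite nth_default// (leq_trans sp).
Qed.

(** * Pairing of coefficient vectors with polynomials *)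

Section MomentPairing.
Variables (F : fieldType) (m : nat) (L : 'I_m -> {scalar {poly F}}).
Implicit Types (n : multi_index m) (k l : 'I_m) (p q : {poly F}).
Implicit Types A B : {ffun 'I_m -> {poly F}}.

(** When [L k] integrates against [w k], this is the integral of [p] times the linear form of
    [A]. *)
Definition pairing A p : F := \sum_(k < m) L k (p * A k).

Fact pairing_is_scalar A : scalar (pairing A).
Proof.
move=> a p q; rewrite /pairing mulr_sumr -big_split; apply: eq_bigr => k _ /=.
by rewrite mulrDl -scalerAl linearP.
Qed.

HB.instance Definition _ A :=
  GRing.isLinear.Build F {poly F} F *%R (pairing A) (pairing_is_scalar A).

Lemma pairingP a A B p : pairing (a *: A + B) p = a * pairing A p + pairing B p.
Proof.
rewrite /pairing mulr_sumr -big_split; apply: eq_bigr => k _ /=.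
by rewrite !ffunE mulrDr -scalerAr linearP.
Qed.

Lemma pairing0 p : pairing 0 p = 0.
Proof. by rewrite /pairing big1// => k _; rewrite ffunE mulr0 linear0. Qed.

Lemma pairingD A B p : pairing (A + B) p = pairing A p + pairing B p.
Proof. by have := pairingP 1 A B p; rewrite scale1r mul1r. Qed.

Lemma pairingZ a A p : pairing (a *: A) p = a * pairing A p.
Proof. by have := pairingP a A 0 p; rewrite pairing0 !addr0. Qed.

Lemma pairingB A B p : pairing (A - B) p = pairing A p - pairing B p.
Proof. by rewrite pairingD -scaleN1r pairingZ mulN1r. Qed.

Lemma pairing_suml (I : Type) (r : seq I) (C : pred I)
    (A : I -> {ffun 'I_m -> {poly F}}) p :
  pairing (\sum_(i <- r | C i) A i) p = \sum_(i <- r | C i) pairing (A i) p.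
Proof.
elim/big_rec2: _ => [|i x B _ <-]; first exact: pairing0.
exact: pairingD.
Qed.

Lemma size_ffunP a A B k d : (size (A k) <= d)%N -> (size (B k) <= d)%N ->
  (size ((a *: A + B)%R k) <= d)%N.
Proof.
move=> sA sB; rewrite !ffunE (leq_trans (size_polyD _ _))// geq_max sB andbT.
by rewrite (leq_trans (size_scale_leq _ _)).
Qed.

Lemma size_ffunD A B k d : (size (A k) <= d)%N -> (size (B k) <= d)%N ->
  (size ((A + B)%R k) <= d)%N.
Proof. by move=> sA sB; rewrite -[A]scale1r size_ffunP. Qed.

Lemma size_ffunB A B k d : (size (A k) <= d)%N -> (size (B k) <= d)%N ->
  (size ((A - B)%R k) <= d)%N.
Proof. by move=> sA sB; rewrite addrC -scaleN1r size_ffunP. Qed.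

Lemma size_ffunZ a A k d : (size (A k) <= d)%N -> (size ((a *: A)%R k) <= d)%N.
Proof. by move=> sA; rewrite ffunE (leq_trans (size_scale_leq _ _)). Qed.

Lemma size_ffun_sum (I : Type) (r : seq I) (C : pred I)
    (A : I -> {ffun 'I_m -> {poly F}}) k d :
  (forall i, C i -> (size (A i k) <= d)%N) ->
  (size ((\sum_(i <- r | C i) A i)%R k) <= d)%N.
Proof.
move=> sA; elim/big_ind: _ => // [|B1 B2 sB1 sB2]; rewrite ffunE.
  by rewrite size_poly0.
by rewrite (leq_trans (size_polyD _ _))// geq_max sB1.
Qed.

Definition mulX A : {ffun 'I_m -> {poly F}} := [ffun k => 'X * A k].

Lemma pairing_mulX A p : pairing (mulX A) p = pairing A (p * 'X).
Proof. by apply: eq_bigr => k _; rewrite ffunE mulrA. Qed.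

Definition orth n p := forall k i, (i < n k)%N -> L k (p * 'X^i) = 0.

Lemma orthP a n p q : orth n p -> orth n q -> orth n (a *: p + q).
Proof.
move=> op oq k i ik.
by rewrite mulrDl -scalerAl linearP/= op// oq// mulr0 addr0.
Qed.

Lemma moment_top k d p q : (forall i, (i < d)%N -> L k (p * 'X^i) = 0) ->
  (size q <= d.+1)%N -> L k (p * q) = q`_d * L k (p * 'X^d).
Proof. exact: (@scalar_coef_top _ (L k \o (p \*o idfun))). Qed.

Lemma moment_low k d p q : (forall i, (i < d)%N -> L k (p * 'X^i) = 0) ->
  (size q <= d)%N -> L k (p * q) = 0.
Proof.
move=> p0 sq; rewrite (moment_top p0) ?(leq_trans sq)//.
by rewrite nth_default ?mul0r.
Qed.

Lemma pairing_orth n A p : orth n p -> (forall k, (size (A k) <= n k)%N) ->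
  pairing A p = 0.
Proof.
by move=> op sA; rewrite /pairing big1// => k _; apply: (moment_low (op k)).
Qed.

(** Orthogonality kills every component but the [k]-th, and there all but the term of degree
    [n k]. *)
Lemma pairing_orth_incr n k A p : orth n p ->
    (forall l, (size (A l) <= mi_incr n k l)%N) ->
  pairing A p = (A k)`_(n k) * L k (p * 'X^(n k)).
Proof.
move=> op sA; rewrite /pairing (bigD1 k)//= (moment_top (op k)); last first.
  by rewrite -(mi_incr_id n k).
rewrite big1 ?addr0// => l lk; apply: (moment_low (op l)).
by rewrite -(mi_incr_neq _ lk).
Qed.

(** * Type II family and non-degeneracy of the pairing *)

Variable P : multi_index m -> {poly F}.
Hypothesis P_monic : forall n, P n \is monic.
Hypothesis size_P : forall n, size (P n) = (mi_size n).+1.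
Hypothesis orth_P : forall n, orth n (P n).
(** Uniqueness of type II polynomials in homogeneous form; the identities between the [P n] are
    proved through it. *)
Hypothesis orth_eq0 :
  forall n p, orth n p -> (size p <= mi_size n)%N -> p = 0.

Lemma P_top n : (P n)`_(mi_size n) = 1.
Proof. by have /monicP := P_monic n; rewrite /lead_coef size_P. Qed.


Definition hcoef n k : F := L k (P n * 'X^(n k)).

(** Otherwise [P n] would satisfy the orthogonality conditions of [n + e_k] with too small a degree,
    and so be zero. *)
Lemma hcoef_neq0 n k : hcoef n k != 0.
Proof.
apply: contra_neq (monic_neq0 (P_monic n)) => h0.
apply: (@orth_eq0 (mi_incr n k)); last by rewrite size_P mi_size_incr.
move=> l i; have [->|lk] := eqVneq l k; last first.
  by rewrite mi_incr_neq//; exact: orth_P.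
rewrite mi_incr_id ltnS leq_eqVlt => /predU1P[->//|].
exact: orth_P.
Qed.

(* Pairing with P (n - e_k) isolates the top coefficient of the k-th component,
   so each size bound can be lowered by one. *)
Lemma pairing_eq0 n A : (forall k, (size (A k) <= n k)%N) ->
  (forall p, (size p <= mi_size n)%N -> pairing A p = 0) -> A = 0.
Proof.
have [s] := ubnP (mi_size n); elim: s n A => // s IHs n A.
rewrite ltnS => ns sA A0.
have top k : (0 < n k)%N -> (A k)`_(n k).-1 = 0.
  move=> nk; set n' := mi_decr n k; have nE : mi_incr n' k = n := mi_decrK nk.
  have := @pairing_orth_incr n' k A (P n') (@orth_P n').
  rewrite nE A0 => [/(_ sA)|]; last by rewrite size_P -nE mi_size_incr.
  move/esym/eqP; rewrite mulf_eq0 (negPf (hcoef_neq0 _ _)) orbF -nE.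
  by rewrite mi_incr_id => /eqP.
have [n0|/mi_size_gt0[k nk]] := posnP (mi_size n).
  apply/ffunP => k; rewrite ffunE; apply/eqP; rewrite -size_poly_leq0.
  by rewrite -(mi_size0 k n0).
have nE := mi_decrK nk.
have szn := mi_size_incr (mi_decr n k) k; rewrite nE in szn.
apply: (IHs (mi_decr n k)); first by rewrite -szn.
  move=> l; have [->|lk] := eqVneq l k; last first.
    by rewrite -(mi_incr_neq (mi_decr n k) lk) nE.
  apply: size_drop_top; first by rewrite -mi_incr_id nE.
  by have := top k nk; rewrite -{1}nE mi_incr_id.
by move=> p sp; apply: A0; rewrite szn ltnW.
Qed.

(* With n = n' + e_k, correct 'X^(n' k) in the k-th component so that its
   moments of order below |n'| vanish; the next one is then hcoef n' k, not 0. *)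
Lemma pairing_onto n (v : nat -> F) : exists A,
  (forall k, (size (A k) <= n k)%N) /\
  (forall i, (i < mi_size n)%N -> pairing A 'X^i = v i).
Proof.
have [s] := ubnP (mi_size n); elim: s n v => // s IHs n v; rewrite ltnS => ns.
have [n0|/mi_size_gt0[k nk]] := posnP (mi_size n).
  by exists 0; split=> [k|i]; rewrite ?n0// ffunE size_poly0.
set n' := mi_decr n k; have nE : mi_incr n' k = n := mi_decrK nk.
have szn := mi_size_incr n' k; rewrite nE in szn.
have n's : (mi_size n' < s)%N by rewrite -szn.
pose E := [ffun l : 'I_m => if l == k then 'X^(n' k) else 0 : {poly F}].
have sE l : (size (E l) <= mi_incr n' k l)%N.
  rewrite ffunE mi_incrE; have [->|_] := eqVneq l k; last by rewrite size_poly0.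
  by rewrite size_polyXn addn1.
have [B [sB BE]] := IHs n' (fun i => pairing E 'X^i) n's.
have [C [sC CE]] := IHs n' v n's.
have EB0 i : (i < mi_size n')%N -> pairing (E - B) 'X^i = 0.
  by move=> ilt; rewrite pairingB BE ?subrr.
(* As [E - B] kills the lower powers and [P n'] is monic, this moment is the pairing with [P n'], to
   which [B] contributes nothing. *)
have EBtop : pairing (E - B) 'X^(mi_size n') = hcoef n' k.
  have := @scalar_coef_top _ (pairing (E - B)) _ (P n') EB0.
  rewrite size_P leqnn => /(_ isT) /=.
  rewrite P_top mul1r => <-.
  rewrite pairingB (pairing_orth (@orth_P n') sB) subr0.
  rewrite (pairing_orth_incr (@orth_P n') sE) ffunE eqxx coefXn eqxx.
  by rewrite mul1r.
pose s' := (v (mi_size n') - pairing C 'X^(mi_size n')) / hcoef n' k.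
exists (s' *: (E - B) + C); split=> [l|i].
  apply: size_ffunP; last by rewrite -nE (leq_trans (sC l)) ?leq_mi_incr.
  rewrite size_ffunB// -nE; first exact: sE.
  by rewrite (leq_trans (sB l)) ?leq_mi_incr.
rewrite szn ltnS leq_eqVlt pairingP => /predU1P[->|ilt].
  by rewrite EBtop /s' divfK ?hcoef_neq0// subrK.
by rewrite EB0// CE// mulr0 add0r.
Qed.

(** * Type I family and nearest-neighbour recurrences *)

Variable A : multi_index m -> {ffun 'I_m -> {poly F}}.
Hypothesis size_A : forall n k, (size (A n k) <= n k)%N.
Hypothesis A_low :
  forall n i, (i.+1 < mi_size n)%N -> pairing (A n) 'X^i = 0.
Hypothesis A_top : forall n i, i.+1 = mi_size n -> pairing (A n) 'X^i = 1.

(** The factor ['X] shifts the index [|n| - 1] so that [|n| = 0] is covered: there [p] is zero. *)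
Lemma pairing_A n p : (size p <= mi_size n)%N ->
  pairing (A n) p = (p * 'X)`_(mi_size n).
Proof.
case sn: (mi_size n) => [|d] sp.
  by move: sp; rewrite size_poly_leq0 => /eqP ->; rewrite linear0 mul0r coef0.
rewrite (@scalar_coef_top _ (pairing (A n)) d)// => [|i id]/=.
  by rewrite A_top// mulr1 coefMX.
by rewrite A_low// sn.
Qed.

Lemma pairing_A_incr n k p : (size p <= (mi_size n).+1)%N ->
  pairing (A (mi_incr n k)) p = p`_(mi_size n).
Proof. by move=> sp; rewrite pairing_A mi_size_incr ?coefMX. Qed.

Lemma size_leq_decomp n p : (size p <= (mi_size n).+1)%N ->
  exists c q, (size q <= mi_size n)%N /\ p = c *: P n + q.
Proof.
move=> sp; exists p`_(mi_size n), (p - p`_(mi_size n) *: P n).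
split; last by rewrite addrC subrK.
apply: size_drop_top; last by rewrite coefB coefZ P_top mulr1 subrr.
rewrite (leq_trans (size_polyD _ _))// geq_max sp size_polyN.
by rewrite (leq_trans (size_scale_leq _ _))// size_P.
Qed.

(** Pair [A (mi_incr n k)] with [P n] in two ways: normalization gives 1, orthogonality gives this
    coefficient times [hcoef n k]. *)
Lemma A_coef_top n k : (A (mi_incr n k) k)`_(n k) = (hcoef n k)^-1.
Proof.
have := pairing_orth_incr (@orth_P n) (@size_A (mi_incr n k)).
rewrite pairing_A_incr ?size_P// P_top => /esym.
by move/(canRL (mulfK (hcoef_neq0 n k))); rewrite mul1r.
Qed.

Lemma A_coef_top_decr n k : (0 < n k)%N ->
  (A n k)`_(n k).-1 = (hcoef (mi_decr n k) k)^-1.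
Proof.
move=> nk; rewrite -A_coef_top mi_decrK//.
by rewrite -[in LHS](mi_decrK nk) mi_incr_id mi_decrK.
Qed.

Lemma A_coef0 n k i : (n k <= i)%N -> (A n k)`_i = 0.
Proof. by move=> nki; rewrite nth_default// (leq_trans (size_A n k)). Qed.

(** By [pairing_eq0] at [n + e_k]: the moments of order at most [|n|] cancel, and the scalar is the
    one that removes degree [n j] from component [j]. *)
Lemma A_sub_incr n j k : j != k ->
  A (mi_incr n j) - A (mi_incr n k) =
  (hcoef (mi_incr n k) j / hcoef n j) *: A (mi_incr (mi_incr n k) j).
Proof.
move=> jk; apply/eqP; rewrite -subr_eq0; apply/eqP.
have sz p : (size p <= (mi_size n).+1)%N ->
    pairing (A (mi_incr (mi_incr n k) j)) p = 0.
  move=> sp; rewrite pairing_A_incr mi_size_incr ?(leq_trans sp)//.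
  by rewrite nth_default.
apply: (@pairing_eq0 (mi_incr n k)) => [l|p]; last first.
  rewrite mi_size_incr => sp.
  by rewrite !pairingB pairingZ sz// mulr0 subr0 !pairing_A_incr// subrr.
have [->{l}|lj] := eqVneq l j.
  rewrite mi_incr_neq//; apply: size_drop_top.
    rewrite !size_ffunB ?size_ffunZ ?(leq_trans (size_A _ _))// ?mi_incr_id//.
    - by rewrite mi_incr_neq.
    - by rewrite mi_incr_neq.
  rewrite !ffunE !coefB coefZ A_coef_top.
  rewrite -{2}(mi_incr_neq n jk) A_coef_top A_coef0 ?mi_incr_neq//.
  by rewrite subr0 mulrAC mulfV ?hcoef_neq0// mul1r subrr.
rewrite !size_ffunB ?size_ffunZ ?(leq_trans (size_A _ _))//.
- by rewrite mi_incr_neq// leq_mi_incr.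
- by rewrite [leqLHS]mi_incr_neq.
Qed.

(** For [n k = 0] truncation makes this quotient 1 rather than 0, hence the restriction [0 < n k] in
    the sums. *)
Definition recA n k : F := hcoef n k / hcoef (mi_decr n k) k.

(** This is the coefficient of degree [|n|] in [P n * 'X - P (mi_incr n k)], because
    [A (mi_incr n k)] annihilates [P (mi_incr n k)]. *)
Definition recB n k : F := pairing (A (mi_incr n k)) (P n * 'X).

(** The difference of the two sides falls under [pairing_eq0] at [n']: the [recA] terms cancel the
    degree [n' l] in each component [l], and the [recB] term settles the moments. *)
Lemma mulX_A n k :
  let n' := mi_incr n k in
  mulX (A n') = A n + recB n k *: A n'
    + \sum_(j < m | (0 < n' j)%N) recA n' j *: A (mi_incr n' j).
Proof.
move=> n'; apply/eqP; rewrite -subr_eq0; apply/eqP.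
apply: (@pairing_eq0 n') => [l|p].
  have le_n' : (n l <= n' l)%N by exact: leq_mi_incr.
  clearbody n'; have szA j : (size (A (mi_incr n' j) l) <= (n' l).+1)%N.
    by rewrite (leq_trans (size_A _ _))// mi_incrE -addn1 leq_add2l leq_b1.
  apply: size_drop_top.
    rewrite size_ffunB ?size_ffunD ?size_ffunZ//.
    - rewrite ffunE (leq_trans (size_polyMleq _ _))// size_polyX addSn.
      by rewrite add1n ltnS size_A.
    - by rewrite (leq_trans (size_A _ _)) ?leqW.
    - by rewrite (leq_trans (size_A _ _)) ?leqW.
    - by apply: size_ffun_sum => j _; rewrite size_ffunZ.
  rewrite !ffunE !coefB !coefD sum_ffunE coef_sum coefZ.
  rewrite (A_coef0 le_n') (A_coef0 (leqnn _)) mulr0 !add0r mulrC coefMX.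
  have A0 j : j != l -> ((recA n' j *: A (mi_incr n' j)) l)`_(n' l) = 0.
    move=> jl; rewrite ffunE coefZ A_coef0 ?mulr0//.
    by rewrite mi_incr_neq// eq_sym.
  have [nl0|nl] := posnP (n' l).
    rewrite big1 ?subrr// => j nj; apply: A0.
    by apply: contraTneq nj => ->; rewrite nl0.
  rewrite (bigD1 l)//= big1 ?addr0 => [|j /andP[_ /A0//]].
  rewrite ffunE coefZ A_coef_top_decr// A_coef_top /recA mulrAC.
  by rewrite mulfV ?hcoef_neq0// mul1r subrr.
rewrite {}/n' mi_size_incr => sp.
rewrite pairingB !pairingD pairingZ pairing_suml.
rewrite big1 ?addr0 => [|j _]; last first.
  rewrite pairingZ pairing_A_incr ?mi_size_incr ?(leq_trans sp)//.
  by rewrite nth_default ?mulr0.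
rewrite pairing_mulX.
(* On [P n] the claim is the definition of [recB]; on the lower part [q] both [A n'] applied to
   [q * 'X] and [A n] applied to [q] read the same coefficient. *)
have [c [q [sq ->]]] := size_leq_decomp sp.
have sqX : (size (q * 'X)%R <= (mi_size n).+1)%N.
  by rewrite (leq_trans (size_polyMleq _ _))// size_polyX addn2.
rewrite mulrDl -scalerAl !linearD !linearZ/= -/(recB n k).
rewrite (pairing_orth (@orth_P n) (@size_A n)) mulr0 add0r.
rewrite (pairing_A_incr _ sqX) (pairing_A sq).
rewrite !pairing_A_incr ?size_P ?(leq_trans sq)// P_top [q`__]nth_default//.
ring.
Qed.

(** The leading terms cancel, and the scalar makes the difference of the two sides orthogonal to
    ['X^(n j)] for [L j]; uniqueness at [n + e_j] concludes. *)
Lemma P_sub_incr n j k : j != k ->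
  P (mi_incr n k) - P (mi_incr n j) =
  (hcoef (mi_incr n k) j / hcoef n j) *: P n.
Proof.
move=> jk; apply/eqP; rewrite -subr_eq0; apply/eqP.
apply: (@orth_eq0 (mi_incr n j)) => [l i ilj|].
  rewrite !mulrBl -scalerAl !linearB linearZ/= (orth_P ilj) subr0; move: ilj.
  have orth_nk : (i < n l)%N -> L l (P (mi_incr n k) * 'X^i) = 0.
    by move=> il; apply: orth_P; rewrite (leq_trans il)// leq_mi_incr.
  have [lj|lj] := eqVneq l j; last first.
    by rewrite mi_incr_neq// => il; rewrite orth_nk// orth_P// mulr0 subrr.
  subst l; rewrite mi_incr_id ltnS leq_eqVlt => /predU1P[->|il]; last first.
    by rewrite orth_nk// orth_P// mulr0 subrr.
  rewrite -/(hcoef n j) divfK ?hcoef_neq0// /hcoef mi_incr_neq//.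
  by rewrite subrr.
rewrite mi_size_incr (leq_trans (size_polyD _ _))// geq_max.
rewrite (@size_sub_monic _ (mi_size n).+1) ?size_P ?mi_size_incr//.
by rewrite size_polyN (leq_trans (size_scale_leq _ _)) ?size_P.
Qed.

(** The difference [D] of the two sides is orthogonal for [n] and has degree below [|n|], so
    uniqueness makes it zero. *)
Lemma mulX_P n k :
  P n * 'X = P (mi_incr n k) + recB n k *: P n
    + \sum_(j < m | (0 < n j)%N) recA n j *: P (mi_decr n j).
Proof.
set n' := mi_incr n k; apply/eqP; rewrite -subr_eq0; apply/eqP.
set S := \sum_(_ < _ | _) _.
have size_decr j : (0 < n j)%N -> (size (P (mi_decr n j)) <= mi_size n)%N.
  by move=> nj; rewrite size_P -(mi_size_incr _ j) mi_decrK.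
have sS : (size S <= mi_size n)%N.
  rewrite /S; elim/big_ind: _ => [|p q sp sq|j nj].
  - by rewrite size_poly0.
  - by rewrite (leq_trans (size_polyD _ _))// geq_max sp.
  - by rewrite (leq_trans (size_scale_leq _ _))// size_decr.
set D := _ - _.
have sD : (size D <= (mi_size n).+1)%N.
  have -> : D = (P n * 'X - P n') - (recB n k *: P n + S) by rewrite /D; ring.
  rewrite (leq_trans (size_polyD _ _))// geq_max size_polyN.
  rewrite (@size_sub_monic _ (mi_size n).+1) ?size_P
    ?mi_size_incr//; last 2 first.
  - by rewrite monicMr ?monicX.
  - by rewrite size_mulX ?size_P ?monic_neq0.
  rewrite (leq_trans (size_polyD _ _))// geq_max (leqW sS) andbT.
  by rewrite (leq_trans (size_scale_leq _ _)) ?size_P.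
apply: (@orth_eq0 n) => [l i il|].
  rewrite /D mulrBl !mulrDl -scalerAl mulr_suml linearB !linearD linearZ.
  rewrite linear_sum/=.
  have -> : L l (P n' * 'X^i) = 0.
    by apply: orth_P; rewrite (leq_trans il)// leq_mi_incr.
  rewrite orth_P// mulr0 !add0r -mulrA -exprS.
  have P0 j : j != l -> L l (recA n j *: P (mi_decr n j) * 'X^i) = 0.
    move=> jl; rewrite -scalerAl linearZ/= orth_P ?mulr0//.
    by rewrite ffunE eq_sym (negPf jl) subn0.
  have nl : (0 < n l)%N by rewrite (leq_trans _ il).
  rewrite (bigD1 l)//= big1 ?addr0 => [|j /andP[_ /P0//]].
  rewrite -scalerAl linearZ/=.
  have dl : mi_decr n l l = (n l).-1 by rewrite ffunE eqxx subn1.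
  (* Multiplication by ['X] raises the order by one, so only [i = n l - 1] meets a non-zero moment,
     [hcoef n l], which the [recA] term for [l] cancels. *)
  move: il; rewrite leq_eqVlt => /predU1P[il|il]; last first.
    by rewrite !orth_P ?mulr0 ?subrr// dl -ltnS prednK.
  have -> : i = mi_decr n l l by rewrite dl -il.
  rewrite -/(hcoef _ l) divfK ?hcoef_neq0// dl prednK//.
  by rewrite subrr.
(* The coefficient of degree [|n|] is read off by pairing with [A n'], where [recB] cancels it. *)
apply: size_drop_top => //; rewrite -(pairing_A_incr k)// /D.
rewrite linearB !linearD linearZ linear_sum/= -/(recB n k).
rewrite (pairing_orth (@orth_P n') (@size_A n')) add0r.
rewrite pairing_A_incr ?size_P// P_top mulr1 big1 ?addr0 ?subrr// => j nj.
rewrite linearZ/= pairing_A_incr ?(leq_trans (size_decr j nj))//.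
by rewrite nth_default ?mulr0 ?size_decr.
Qed.

(** * The Christoffel-Darboux formula at fixed points *)

Variables (c : 'I_m -> F) (x y : F).

(** Here [c k] stands for the value of the [k]-th weight at [y]. *)
Definition form_at B : F := \sum_(k < m) (B k).[y] * c k.

Fact form_at_is_scalar : scalar form_at.
Proof.
move=> a B C; rewrite /form_at mulr_sumr -big_split; apply: eq_bigr => k _ /=.
by rewrite !ffunE hornerD hornerZ mulrDl mulrA.
Qed.

HB.instance Definition _ :=
  GRing.isLinear.Build F {ffun 'I_m -> {poly F}} F *%R form_at
    form_at_is_scalar.

Lemma form_at_mulX B : form_at (mulX B) = y * form_at B.
Proof.
rewrite /form_at mulr_sumr; apply: eq_bigr => k _.
by rewrite ffunE hornerM hornerX mulrA.
Qed.

Definition cd_rhs n : F :=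
  (P n).[x] * form_at (A n)
  - \sum_(k < m | (0 < n k)%N)
      recA n k * (P (mi_decr n k)).[x] * form_at (A (mi_incr n k)).

(** The sums agree term by term. For [j = k] both terms vanish; otherwise, with [r = n - e_j], both
    are [- hcoef (n + e_k) j / hcoef r j] times [P r] at [x] times the form of
    [A (n + e_j + e_k)]. *)
Lemma cross_terms n k :
  \sum_(j < m | (0 < n j)%N) recA n j * (P (mi_decr n j)).[x]
     * (form_at (A (mi_incr n k)) - form_at (A (mi_incr n j)))
  = \sum_(j < m | (0 < mi_incr n k j)%N) recA (mi_incr n k) j
     * ((P n).[x] - (P (mi_decr (mi_incr n k) j)).[x])
     * form_at (A (mi_incr (mi_incr n k) j)).
Proof.
rewrite big_mkcond [RHS]big_mkcond; apply: eq_bigr => j _.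
have [->|jk] := eqVneq j k.
  by rewrite mi_incrK !subrr !(mulr0, mul0r) !if_same.
rewrite mi_incr_neq//; case: ifP => // nj.
rewrite mi_incr_decr 1?eq_sym//; set r := mi_decr n j.
have nE : n = mi_incr r j by rewrite mi_decrK.
have Pd := congr1 (horner^~ x) (P_sub_incr r jk).
have Ad := congr1 form_at (A_sub_incr n jk).
rewrite hornerD hornerN hornerZ -nE in Pd; rewrite linearB linearZ/= in Ad.
have -> : recA (mi_incr n k) j = hcoef (mi_incr n k) j / hcoef (mi_incr r k) j.
  by rewrite /recA mi_incr_decr 1?eq_sym.
rewrite /recA -/r -opprB Ad -[_.[x] - _]opprB Pd.
by field; rewrite !hcoef_neq0.
Qed.

Lemma cd_step n k :
  (x - y) * ((P n).[x] * form_at (A (mi_incr n k))) =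
  cd_rhs (mi_incr n k) - cd_rhs n.
Proof.
set n' := mi_incr n k.
have /(congr1 (horner^~ x)) := mulX_P n k.
rewrite hornerMX !hornerD hornerZ horner_sum -/n' => xP.
have /(congr1 form_at) := mulX_A n k.
rewrite form_at_mulX !linearD linearZ linear_sum/= -/n' => yA.
have := cross_terms n k; rewrite -/n'.
under eq_bigr do rewrite mulrBr.
under [in X in _ = X]eq_bigr do rewrite mulrBr mulrBl.
rewrite !sumrB -/n' => cross.
have xP' : x * (P n).[x] * form_at (A n') =
    (P n').[x] * form_at (A n') + recB n k * (P n).[x] * form_at (A n') +
    \sum_(j < m | (0 < n j)%N)
      recA n j * (P (mi_decr n j)).[x] * form_at (A n').
  rewrite [x * _]mulrC xP !mulrDl; congr (_ + _).
  by rewrite mulr_suml; apply: eq_bigr => j _; rewrite hornerZ.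
have yA' : y * (P n).[x] * form_at (A n') =
    (P n).[x] * form_at (A n) + recB n k * (P n).[x] * form_at (A n') +
    \sum_(j < m | (0 < n' j)%N)
      recA n' j * (P n).[x] * form_at (A (mi_incr n' j)).
  rewrite -mulrA mulrCA yA !mulrDr; congr (_ + _ + _).
    by rewrite mulrCA mulrA.
  by rewrite mulr_sumr; apply: eq_bigr => j _; rewrite linearZ/= mulrCA mulrA.
rewrite mulrBl !mulrA xP' yA' /cd_rhs.
move/eqP: cross; rewrite subr_eq => /eqP ->.
by ring.
Qed.

Lemma christoffel_darboux_abstract (d : nat) (nn : nat -> multi_index m) :
  (forall j, (j <= d)%N -> mi_size (nn j) = j) ->
  (forall j, (j < d)%N -> mi_le (nn j) (nn j.+1)) ->
  (x - y) * (\sum_(j < d) (P (nn j)).[x] * form_at (A (nn j.+1)))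
    = cd_rhs (nn d).
Proof.
elim: d => [|d IHd] nn_size nn_le.
  (* At [d = 0] all components of [nn 0] are zero, so the subtracted sum is empty and the size
     bounds force [A (nn 0)] to be zero. *)
  rewrite big_ord0 mulr0 /cd_rhs.
  have n0 k : nn 0%N k = 0%N by apply: mi_size0; exact: nn_size.
  rewrite big_pred0 ?subr0 => [|k]; last by rewrite n0.
  rewrite [form_at _]big1 ?mulr0// => k _.
  have := size_A (nn 0%N) k; rewrite n0 size_poly_leq0 => /eqP ->.
  by rewrite horner0 mul0r.
have [k nnE] : exists k, nn d.+1 = mi_incr (nn d) k.
  by apply: mi_le_incr; [exact: nn_le | rewrite !nn_size].
rewrite big_ord_recr/= mulrDr IHd => [|j jd|j jd]; last first.
- by apply: nn_le; exact: ltnW.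
- by apply: nn_size; exact: ltnW.
by rewrite nnE cd_step addrC subrK.
Qed.

End MomentPairing.

(** * Moment functionals of the weights *)

Section Moments.
Variables (R : realType) (m : nat) (w : 'I_m -> R -> R).
Hypothesis w_moments : moments_exist w.

Local Notation leb := (@lebesgue_measure R).

Lemma integrable_poly_weight k (p : {poly R}) :
  leb.-integrable setT (EFin \o (fun x => p.[x] * w k x)).
Proof.
have -> : EFin \o (fun x => p.[x] * w k x) =
    (fun x => \sum_(i < size p) ((p`_i)%R%:E * (x ^+ i * w k x)%:E)%E).
  apply/funext => x /=; rewrite horner_coef mulr_suml -sumEFin.
  by apply: eq_bigr => i _; rewrite -EFinM mulrA.
by apply: integrable_sum => // i _; apply: integrableZl.
Qed.

Definition moment k (p : {poly R}) : R :=
  \int[leb]_(x in setT) (p.[x] * w k x).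

Fact moment_is_scalar k : scalar (moment k).
Proof.
move=> a p q; rewrite /moment -RintegralZl ?integrable_poly_weight//.
rewrite -RintegralD ?integrable_poly_weight//.
  by apply: eq_Rintegral => x _; rewrite hornerD hornerZ mulrDl mulrA.
exact: (integrableZl measurableT a (integrable_poly_weight k p)).
Qed.

HB.instance Definition _ k :=
  GRing.isLinear.Build R {poly R} R *%R (moment k) (moment_is_scalar k).

Definition moment_form k : {scalar {poly R}} := moment k.

Lemma moment_mulXn k p i :
  moment_form k (p * 'X^i) = \int[leb]_(x in setT) (p.[x] * x ^+ i * w k x).
Proof. by apply: eq_Rintegral => x _; rewrite hornerM hornerXn. Qed.

Lemma pairing_moment A p :
  pairing moment_form A p = \int[leb]_(x in setT) (p.[x] * linear_form w A x).
Proof.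
rewrite /pairing /moment_form /moment /=.
under [RHS]eq_Rintegral do rewrite mulr_sumr.
under [RHS]eq_Rintegral do under eq_bigr do rewrite mulrA -hornerM.
elim: (index_enum _) => [|k r IHr].
  rewrite big_nil; under eq_Rintegral do rewrite big_nil.
  by rewrite Rintegral_cst// mul0r.
rewrite big_cons IHr -RintegralD ?integrable_poly_weight//.
  by apply: eq_Rintegral => x _; rewrite big_cons.
rewrite (_ : _ \o _ =
    fun x => (\sum_(l <- r) ((p * A l)%R.[x] * w l x)%:E)%E).
  by apply: integrable_sum => // l _; apply: integrable_poly_weight.
by apply/funext => x /=; rewrite sumEFin.
Qed.

Lemma is_typeIIP n p : is_typeII w n p <->
  [/\ p \is monic, size p = (mi_size n).+1 & orth moment_form n p].
Proof.
split=> -[? ? op]; split=> // k i ik; first by rewrite moment_mulXn op.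
by rewrite -moment_mulXn op.
Qed.

Lemma pairing_momentXn A i :
  pairing moment_form A 'X^i
    = \int[leb]_(x in setT) (x ^+ i * linear_form w A x).
Proof.
by rewrite pairing_moment; apply: eq_Rintegral => x _; rewrite hornerXn.
Qed.

Hypothesis w_perfect : perfect w.

Lemma typeIIP n : is_typeII w n (typeII w n).
Proof. by apply: xgetPex; have [p [pP _]] := w_perfect n; exists p. Qed.

Lemma monic_typeII n : typeII w n \is monic.
Proof. by have [] := typeIIP n. Qed.

Lemma size_typeII n : size (typeII w n) = (mi_size n).+1.
Proof. by have [] := typeIIP n. Qed.

Lemma orth_typeII n : orth moment_form n (typeII w n).
Proof. by have /is_typeIIP[] := typeIIP n. Qed.

(** Adding such a [p] to the type II polynomial preserves all its defining conditions, so uniqueness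
    forces [p = 0]. *)
Lemma perfect_orth_eq0 n p :
  orth moment_form n p -> (size p <= mi_size n)%N -> p = 0.
Proof.
move=> op sp; have [q [_ q_uniq]] := w_perfect n.
have /is_typeIIP[mP sP oP] := typeIIP n; set P := typeII w n in mP sP oP *.
have ltp : (size p < size P)%N by rewrite sP.
have : is_typeII w n (P + p).
  apply/is_typeIIP; split; last 1 first.
  - by rewrite addrC -[p]scale1r; apply: orthP.
  - by rewrite monicE lead_coefDl// -monicE.
  - by rewrite size_polyDl.
by move/q_uniq; rewrite (q_uniq _ (typeIIP n)) -[LHS]addr0 => /addrI.
Qed.

(** Perfectness speaks of type II only; existence for type I comes from [pairing_onto], prescribing
    moment 1 at order [|n| - 1] and 0 below. *)
Lemma typeIP n : is_typeI w n (typeI w n).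
Proof.
apply: xgetPex.
have [A [sA AE]] := pairing_onto monic_typeII size_typeII orth_typeII
  perfect_orth_eq0 n (fun i => (i.+1 == mi_size n)%:R).
exists A; split=> // j jn; rewrite -pairing_momentXn AE.
- by rewrite ltn_eqF.
- exact: ltnW.
- by rewrite jn eqxx.
- by rewrite -jn.
Qed.

Lemma hcoef_typeII n k : hcoef moment_form (typeII w) n k = hnum w n k.
Proof. exact: moment_mulXn. Qed.

End Moments.

Theorem theorem1p1 (R : realType) (m : nat) (hm : (2 <= m)%N)
  (w : 'I_m -> R -> R)
  (w_ge0 : forall (j : 'I_m) (x : R), 0 <= w j x)
  (w_moments : moments_exist w)
  (w_perfect : perfect w)
  (n : nat) (nn : nat -> multi_index m)
  (nn_size : forall j : nat, (j <= n)%N -> mi_size (nn j) = j)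
  (nn_le : forall j : nat, (j < n)%N -> mi_le (nn j) (nn j.+1))
  (x y : R) :
  (x - y) * (\sum_(j < n)
      (typeII w (nn j)).[x] * typeI_form w (nn j.+1) y) =
  (typeII w (nn n)).[x] * typeI_form w (nn n) y
  - \sum_(k < m | (0 < nn n k)%N)
      hnum w (nn n) k / hnum w (mi_decr (nn n) k) k
      * (typeII w (mi_decr (nn n) k)).[x]
      * typeI_form w (mi_incr (nn n) k) y.
Proof.
have size_A k l : (size (typeI w k l) <= k l)%N.
  by have [sA _ _] := typeIP w_moments w_perfect k.
have A_low k i : (i.+1 < mi_size k)%N ->
    pairing (moment_form w_moments) (typeI w k) 'X^i = 0.
  rewrite pairing_momentXn.
  by have [_ + _] := typeIP w_moments w_perfect k; apply.
have A_top k i : i.+1 = mi_size k ->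
    pairing (moment_form w_moments) (typeI w k) 'X^i = 1.
  rewrite pairing_momentXn.
  by have [_ _] := typeIP w_moments w_perfect k; apply.
(* Taking [c k] to be [w k y] turns [form_at] into [typeI_form] at [y]. *)
rewrite (christoffel_darboux_abstract (monic_typeII w_perfect)
  (size_typeII w_perfect) (orth_typeII w_moments w_perfect)
  (perfect_orth_eq0 w_perfect) size_A A_low A_top (fun k => w k y) x y
  nn_size nn_le).
rewrite /cd_rhs /recA; congr (_ - _); apply: eq_bigr => k _.
by rewrite !hcoef_typeII.
Qed.
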